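(* Let $k\geq 2$ be an integer and let $F\in\mathcal{F}$. Then the Tukey median of the probability measure $P_{k,F}$ on $\mathbb{R}^k$ is $\mu_k = k^{-1}1_k = (1/k,\ldots,1/k)'\in\mathbb{R}^k$.
   Context: $\mathcal{F}$ denotes the collection of cumulative distribution functions $F$ on $\mathbb{R}$ such that (i) $F(0)=0$ and (ii) $F$ is concave on $(0,+\infty)$ (i.e. cumulative distribution functions of random variables that are almost surely positive and unimodal at $0$). For an integer $k\geq 2$ and $F\in\mathcal{F}$, let $V_{k1},\ldots,V_{kk}$ be mutually independent random variables, each with cumulative distribution function $F$, and let $$X_k=(X_{k1},\ldots,X_{kk})'=\frac{(V_{k1},\ldots,V_{kk})'}{\sum_{\ell=1}^k V_{k\ell}}.$$ $P_{k,F}$ denotes the distribution of $X_k$, a probability measure over $\mathbb{R}^k$. A prime denotes transpose, and $1_k=(1,\ldots,1)'\in\mathbb{R}^k$. Halfspace depth: with $\mathcal{S}^{k-1}=\{x\in\mathbb{R}^k: x'x=1\}$, the halfspace depth of $\theta\in\mathbb{R}^k$ with respect to a probability measure $P$ over $\mathbb{R}^k$ is $$HD(\theta,P)=\inf_{u\in\mathcal{S}^{k-1}} P[u'(X-\theta)\geq 0],$$ where $X$ has distribution $P$. Tukey median: for a probability measure $P$ over $\mathbb{R}^k$, let $C_P$ be the set of points $\theta\in\mathbb{R}^k$ maximizing $HD(\theta,P)$ over $\mathbb{R}^k$ (the deepest points of $P$; this set is known to be nonempty and convex). The Tukey median of $P$ is the barycentre of $C_P$, i.e. its center of mass (with respect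 to Lebesgue measure on the affine hull of $C_P$). *)

(* Defs.v *)
From HB Require Import structures.
From mathcomp Require Import all_boot all_order all_algebra.
From mathcomp Require Import all_classical all_reals all_analysis.
From mathcomp Require Import measurable_realfun.

Set Implicit Arguments.
Unset Strict Implicit.
Unset Printing Implicit Defensive.

Import Order.TTheory GRing.Theory Num.Theory.
Import numFieldNormedType.Exports.

Local Open Scope classical_set_scope.
Local Open Scope ring_scope.

(* The product sigma-algebra on matrices, generated by the entries, in the same
   way as the library does for tuples; on 'cV[R]_k it is the Borel
   sigma-algebra of R^k. *)
Definition measure_matrix_display : measure_display -> measure_display.
Proof. exact. Qed.

Section measurable_matrix.
Context {d} {T : measurableType d} (m n : nat).

Definition matrix_measurable : set (set 'M[T]_(m, n)) :=
  <<s \bigcup_(ij in [set: 'I_m * 'I_n])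
        preimage_set_system setT (fun A : 'M[T]_(m, n) => A ij.1 ij.2)
          measurable >>.

Let matrix_set0 : matrix_measurable set0.
Proof. exact: sigma_algebra0. Qed.

Let matrix_setC A : matrix_measurable A -> matrix_measurable (~` A).
Proof. exact: sigma_algebraC. Qed.

Let matrix_bigcup (F : (set 'M[T]_(m, n))^nat) :
  (forall i, matrix_measurable (F i)) -> matrix_measurable (\bigcup_i (F i)).
Proof. exact: sigma_algebra_bigcup. Qed.

HB.instance Definition _ := @isMeasurable.Build (measure_matrix_display d)
  'M[T]_(m, n) matrix_measurable matrix_set0 matrix_setC matrix_bigcup.

End measurable_matrix.

Lemma measurable_mxE d (T : measurableType d) m n (i : 'I_m) (j : 'I_n) :
  measurable_fun [set: 'M[T]_(m, n)] (fun A : 'M[T]_(m, n) => A i j).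
Proof.
move=> _ Y mY; rewrite setTI; apply: sub_sigma_algebra.
by exists (i, j) => //=; exists Y => //; rewrite setTI.
Qed.

Lemma measurable_fun_mxP d d' (T1 : measurableType d) (T2 : measurableType d')
    m n (f : T1 -> 'M[T2]_(m, n)) :
  (forall i j, measurable_fun [set: T1] (fun x => f x i j)) ->
  measurable_fun [set: T1] f.
Proof.
move=> mf _ Y mY; rewrite setTI.
have sub : @matrix_measurable _ T2 m n `<=` [set Z | measurable (f @^-1` Z)];
  last exact: sub.
apply: smallest_sub.
  split => [|A mA|A mA] /=; first by rewrite preimage_set0.
    by rewrite setTD preimage_setC; exact: measurableC.
  by rewrite preimage_bigcup; apply: bigcup_measurable => l _; exact: mA.
move=> _ [[i j] _ [B mB <-]] /=; rewrite setTI.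
by have := mf i j measurableT B mB; rewrite setTI.
Qed.

Lemma measurable_invr (R : realType) :
  measurable_fun [set: R] (@GRing.inv R).
Proof.
have m0 : measurable [set 0 : R] by exact: measurable_set1.
rewrite -(setUv [set 0 : R]); apply/measurable_funU => //.
  exact: measurableC.
split; first exact: measurable_fun_set1.
apply: open_continuous_measurable_fun.
  by apply: closed_openC; exact: closed_eq.
by move=> x; rewrite inE /= => /eqP x0; exact: inv_continuous.
Qed.

(* The library's sigma_finite_measure instance on m1 \x m2 is shadowed by the
   one for subprobabilities. *)
Lemma product_sigma_finite d1 d2 (T1 : measurableType d1)
    (T2 : measurableType d2) (R : realType)
    (m1 : {sigma_finite_measure set T1 -> \bar R})
    (m2 : {sigma_finite_measure set T2 -> \bar R}) :
  sigma_finite setT (m1 \x m2)%E.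
Proof.
have /sigma_finiteP[F [TF ndF Foo]] := sigma_finiteT m1.
have /sigma_finiteP[G [TG ndG Goo]] := sigma_finiteT m2.
exists (fun n => F n `*` G n).
  rewrite -setXTT TF TG predeqE => -[x y]; split.
    move=> [/= [n _ Fnx] [k _ Gky]]; exists (maxn n k) => //; split.
    - by move: x Fnx; exact/subsetPset/ndF/leq_maxl.
    - by move: y Gky; exact/subsetPset/ndG/leq_maxr.
  by move=> [n _ []/= ? ?]; split; exists n.
move=> k; have [? ?] := Foo k; have [? ?] := Goo k.
split; first exact: measurableX.
by rewrite product_measure1E// lte_mul_pinfty// ge0_fin_numE.
Qed.

Section lebesgue.
Context {R : realType}.
Local Open Scope ereal_scope.

Section step.
Variables (n : nat) (mu : {sigma_finite_measure set 'cV[R]_n -> \bar R}).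

Definition cV_cons (z : R * 'cV[R]_n) : 'cV[R]_n.+1 :=
  \col_i oapp (fun j => z.2 j 0%R) z.1 (unlift ord0 i).

Definition cV_uncons (x : 'cV[R]_n.+1) : R * 'cV[R]_n :=
  (x ord0 0%R, \col_j x (lift ord0 j) 0%R).

Lemma cV_unconsK : cancel cV_uncons cV_cons.
Proof.
move=> x; apply/colP => i; rewrite mxE /=.
by case: unliftP => [j|] -> /=; rewrite ?mxE.
Qed.

Lemma cV_consK : cancel cV_cons cV_uncons.
Proof.
move=> [r y]; rewrite /cV_uncons mxE unlift_none /=; congr pair.
by apply/colP => j; rewrite !mxE liftK.
Qed.

Lemma measurable_cV_cons : measurable_fun [set: R * 'cV[R]_n] cV_cons.
Proof.
apply: measurable_fun_mxP => i j.
under eq_fun do rewrite mxE.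
case: (unlift ord0 i) => [l|] /=; last exact: measurable_fst.
apply: (measurableT_comp (f := fun A : 'cV[R]_n => A l 0%R)).
  exact: measurable_mxE.
exact: measurable_snd.
Qed.

Lemma measurable_cV_uncons : measurable_fun [set: 'cV[R]_n.+1] cV_uncons.
Proof.
apply/measurable_fun_pairP; split; first exact: measurable_mxE.
apply: measurable_fun_mxP => i j /=.
under eq_fun do rewrite mxE.
exact: measurable_mxE.
Qed.

Definition lebesgue_cV_step : set 'cV[R]_n.+1 -> \bar R :=
  pushforward (@lebesgue_measure R \x mu) cV_cons.

Let step0 : lebesgue_cV_step set0 = 0.
Proof. by rewrite /lebesgue_cV_step /pushforward preimage_set0 measure0. Qed.

Let step_ge0 A : 0 <= lebesgue_cV_step A.
Proof. by rewrite /lebesgue_cV_step /pushforward; exact: measure_ge0. Qed.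

Let step_sigma_additive : semi_sigma_additive lebesgue_cV_step.
Proof.
have mc : measurable_fun setT cV_cons := measurable_cV_cons.
move=> F mF tF mUF; rewrite /lebesgue_cV_step /pushforward preimage_bigcup.
apply: measure_semi_sigma_additive.
- by move=> i; rewrite -[X in measurable X]setTI; exact: mc.
- apply/trivIsetP => /= i j _ _ ij; rewrite -preimage_setI.
  by move/trivIsetP : tF => /(_ _ _ _ _ ij) ->//; rewrite preimage_set0.
- by rewrite -preimage_bigcup -[X in measurable X]setTI; exact: mc.
Qed.

HB.instance Definition _ := isMeasure.Build _ _ _ lebesgue_cV_step
  step0 step_ge0 step_sigma_additive.

Let step_sigma_finite : sigma_finite setT lebesgue_cV_step.
Proof.
have [F UF mF] := product_sigma_finite (@lebesgue_measure R) mu.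
exists (fun i => cV_uncons @^-1` F i).
  by rewrite -preimage_bigcup -UF preimage_setT.
move=> i; have [mFi Fioo] := mF i; split.
  rewrite -[X in measurable X]setTI; exact: measurable_cV_uncons.
rewrite /lebesgue_cV_step /pushforward -comp_preimage.
by rewrite (_ : cV_uncons \o cV_cons = id) //; apply/funext; exact: cV_consK.
Qed.

HB.instance Definition _ := Measure_isSigmaFinite.Build _ _ _ lebesgue_cV_step
  step_sigma_finite.

End step.

(* Lebesgue measure on R^n, as an iterated product; on R^0 it is the unit mass
   at the only point. *)
Fixpoint lebesgue_cV (n : nat) : {sigma_finite_measure set 'cV[R]_n -> \bar R} :=
  match n with
  | 0%N => \d_(0%R : 'cV[R]_0)
  | n'.+1 => lebesgue_cV_step (lebesgue_cV n')
  end.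

End lebesgue.
Arguments lebesgue_cV : clear implicits.

Section barycenter.
Context {R : realType} (k : nat).
Implicit Types (C : set 'cV[R]_k).

Definition affine_hull C : set 'cV[R]_k :=
  [set x | exists (n : nat) (p : 'I_n -> 'cV[R]_k) (c : 'I_n -> R),
    [/\ forall i, C (p i), \sum_i c i = 1 & x = \sum_i c i *: p i]].

(* Lebesgue measure on the affine hull of C is the image of Lebesgue measure on
   R^n under an isometric parametrization y |-> a + B y of the hull; it does
   not depend on the choice of a and of the orthonormal columns of B. *)
Definition is_barycenter C (m : 'cV[R]_k) : Prop :=
  exists (n : nat) (a : 'cV[R]_k) (B : 'M[R]_(k, n)),
    let phi := fun y : 'cV[R]_n => a + B *m y in
    let S := phi @^-1` C in
    let mu := lebesgue_cV R n in
    [/\ B^T *m B = 1%:M,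
        affine_hull C = range phi,
        measurable S,
        (0 < mu S < +oo)%E
      & forall i : 'I_k,
          mu.-integrable S (EFin \o (fun y => phi y i 0)) /\
          m i 0 = Rintegral mu S (fun y => phi y i 0) / fine (mu S)].

End barycenter.

Section depth.
Context {R : realType} (k : nat).
Variable Q : probability 'cV[R]_k R.

Definition unit_sphere : set 'cV[R]_k := [set u | (u^T *m u) 0 0 = 1].

Definition halfspace_depth (theta : 'cV[R]_k) : \bar R :=
  ereal_inf [set Q [set x | 0 <= (u^T *m (x - theta)) 0 0] | u in unit_sphere].

Definition deepest_points : set 'cV[R]_k :=
  [set theta |
    forall eta, (halfspace_depth eta <= halfspace_depth theta)%E].

Definition is_tukey_median (m : 'cV[R]_k) : Prop :=
  is_barycenter deepest_points m.

End depth.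

(* The type cumulativeBounded 0 1 already says that F is a cumulative
   distribution function: nondecreasing, right-continuous, with limits 0 at
   -oo and 1 at +oo. *)
Definition unimodal_cdf (R : realType) (F : cumulativeBounded (0 : R) (1 : R)) :=
  F 0 = 0 /\
  convex_function (E := R^o) `]0, +oo[%classic (fun x : R => - F x).

Section random_vector.
Context {d} {T : measurableType d} {R : realType} {P : probability T R}.
Context {k : nat}.
Variable V : 'I_k -> {RV P >-> R}.

Definition mutually_independent : Prop :=
  forall (J : {set 'I_k}) (A : 'I_k -> set R), (forall i, measurable (A i)) ->
    P (\bigcap_(i in [set` J]) (V i @^-1` A i)) =
    (\prod_(i in J) P (V i @^-1` A i))%E.

(* Division by 0 yields 0; this only matters where the sum vanishes, which is
   a null event when the V i are almost surely positive and 0 < k. *)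
Definition normalize (w : T) : 'cV[R]_k := \col_i (V i w / \sum_l V l w).

Lemma measurable_normalize : measurable_fun [set: T] normalize.
Proof.
apply: measurable_fun_mxP => i j.
under eq_fun do rewrite mxE.
apply: measurable_funM => //.
apply: measurableT_comp; last by apply: measurable_sum => l.
exact: measurable_invr.
Qed.

HB.instance Definition _ :=
  isMeasurableFun.Build _ _ _ _ normalize measurable_normalize.

End random_vector.

(* Main.v *)
Require Import Defs.
From HB Require Import structures.
From mathcomp Require Import all_boot all_order all_algebra.
From mathcomp Require Import all_classical all_reals all_analysis.
From mathcomp Require Import measurable_realfun fingroup perm.
From mathcomp Require Import ring lra.

Set Implicit Arguments.
Unset Strict Implicit.
Unset Printing Implicit Defensive.

Import Order.TTheory GRing.Theory Num.Theory.
Import numFieldNormedType.Exports.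

Local Open Scope classical_set_scope.
Local Open Scope ring_scope.

(** The centre c = (1/k, ..., 1/k) is the only deepest point, so that the
    barycentre of the set of deepest points is a barycentre of a singleton.

    On the almost sure event that all V_i are positive, the inequality
    u'(X - theta) >= 0 amounts to sum_i (u_i - u'theta) V_i >= 0.  Write H(a)
    for the probability of sum_i a_i V_i >= 0.  The law of V is exchangeable
    (exchangeable), so H is unchanged when the entries of a are permuted
    (halfspace_perm).  At theta = c the vector u_i - u'theta has sum zero, and
    the sum of sum_i w_(s i) V_i over all permutations s vanishes when w has
    sum zero; hence H(w) >= 1/k! (halfspace_mass), and the depth of c is at
    least 1/k!.

    Let theta differ from c.  If its coordinates do not add up to 1, a
    direction parallel to (1, ..., 1) shows that its depth is 0.  Otherwise
    t = theta - c has sum zero, and every nonzero w with sum zero has a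
    permutation v = w o s such that v't >= delta max |w_i|, where delta > 0
    depends on t only (exists_perm_align).  The depth of theta is at most
    H(v - v't), and H(v) - H(v - v't) is the probability of
    0 <= sum_i v_i V_i < v't sum_i V_i.  That event contains the one where
    sum_i v_i V_i >= 0 and all V_i lie in one interval ]r, r(1 + h)] with
    h <= delta, which has probability at least a 1/k! share of the probability
    of the cube (halfspace_shift_gap).  The cube has positive probability for
    a suitable r, because a cumulative distribution function vanishing at 0
    increases on some interval ]r, r(1 + h)] (cumulative_geometric_jump).
    Hence H(w) = H(v) exceeds the depth of theta by a constant that does not
    depend on w (uniform_gap), and the depth of theta is smaller than that of
    c (depth_center_gt). *)

(** * Sums over the symmetric group *)

Lemma sum_perm0 (R : numFieldType) (k : nat) (w v : 'I_k -> R) :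
  \sum_i w i = 0 -> \sum_(s : 'S_k) \sum_i w (s i) * v i = 0.
Proof.
move=> w0; rewrite exchange_big /=.
under eq_bigr do rewrite -mulr_suml.
apply: big1 => i _; suff -> : \sum_(s : 'S_k) w (s i) = 0 by rewrite mul0r.
have const j : \sum_(s : 'S_k) w (s j) = \sum_(s : 'S_k) w (s i).
  rewrite (reindex_inj (mulgI (tperm i j))) /=.
  by apply: eq_bigr => s _; rewrite permM tpermR.
have : \sum_(j < k) \sum_(s : 'S_k) w (s j) = 0.
  rewrite exchange_big big1 //= => s _; rewrite -[RHS]w0.
  by rewrite [RHS](reindex_inj (@perm_inj _ s)).
rewrite (eq_bigr _ (fun j _ => const j)) sumr_const card_ord.
have /lt0n_neq0/negPf k0 : (0 < k)%N by exact: leq_ltn_trans (ltn_ord i).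
by move/eqP; rewrite mulrn_eq0 k0 => /eqP.
Qed.

(** The inner products of [t] with the rearrangements of [w] add up to zero, and
    two of them, for permutations that differ by the transposition of [i] and
    [j], differ by [(w a - w b) * (t i - t j)]; hence one of the [k!] inner
    products is at least [1 / k!] times that number. *)
Lemma exists_perm_align (R : realFieldType) (k : nat) (w t : 'I_k -> R)
    (a b i j : 'I_k) : \sum_l w l = 0 -> a != b -> i != j ->
  exists s : 'S_k,
    (w a - w b) * (t i - t j) / k`!%:R <= \sum_l w (s l) * t l.
Proof.
move=> w0 ab ij; set W := (w a - w b) * (t i - t j).
have k0 : 0 < k`!%:R :> R by rewrite ltr0n fact_gt0.
apply: contrapT => /forallNP small.
pose f (s : 'S_k) := \sum_l w (s l) * t l.
have {}small s : f s < W / k`!%:R.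
  by rewrite ltNge; apply/negP; exact: (small s).
have sumf : \sum_s f s = 0 by exact: sum_perm0.
have [s [sia sjb]] : exists s : 'S_k, s i = a /\ s j = b.
  exists (tperm i a * tperm (tperm i a j) b)%g.
  rewrite !permM tpermL; split; last by rewrite tpermL.
  have ja : tperm i a j != a.
    by rewrite -{2}(tpermL i a) (inj_eq perm_inj) eq_sym.
  by rewrite (tpermD ja) // eq_sym.
pose s' := (tperm i j * s)%g.
have ff' : f s - f s' = W.
  rewrite /f -sumrB (bigD1 i) //= (bigD1 j) ?(eq_sym j) //= big1 ?addr0.
    by rewrite !permM tpermL tpermR sia sjb /W; ring.
  by move=> l /andP[li lj]; rewrite permM tpermD 1?eq_sym // subrr.
have ss' : s' != s.
  apply/eqP => /permP /(_ i); rewrite permM tpermL sia sjb => ba.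
  by rewrite ba eqxx in ab.
have sumW : \sum_(r : 'S_k) W / k`!%:R = W.
  rewrite sumr_const card_Sn -[X in X = _]mulr_natr.
  by rewrite divfK // gt_eqF.
(* If all terms are below W / k!, then f s' = - (the sum of the others) is
   above W / k! - W, so that f s - f s' < W. *)
have : \sum_(r | r != s') f r < \sum_(r : 'S_k | r != s') W / k`!%:R.
  apply: ltr_sum => //; apply/hasP; exists s; first exact: mem_index_enum.
  by rewrite eq_sym.
rewrite (bigD1 s') //= in sumf; rewrite (bigD1 s') //= in sumW.
move/eqP: sumf; rewrite addrC addr_eq0 => /eqP ->.
have -> : \sum_(r : 'S_k | r != s') W / k`!%:R = W - W / k`!%:R.
  by rewrite -[X in _ = X - _]sumW addrAC subrr add0r.
by have := small s; rewrite -{2}ff'; set c := W / _; lra.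
Qed.

(** In a nonzero vector with sum zero, the difference between the largest and
    the smallest entry is positive and bounds all entries in absolute value. *)
Lemma exists_oscillation (R : realDomainType) (k : nat) (w : 'I_k -> R)
    (i0 : 'I_k) : \sum_l w l = 0 -> w i0 != 0 ->
  exists a b : 'I_k, w b < w a /\ forall l, `|w l| <= w a - w b.
Proof.
move=> w0 wi0.
pose a := [arg max_(i > i0) w i]%O; pose b := [arg min_(i < i0) w i]%O.
have aP l : w l <= w a by rewrite /a; case: arg_maxP => // x _; exact.
have bP l : w b <= w l by rewrite /b; case: arg_minP => // x _; exact.
have k0 : (0 < k)%N by exact: leq_ltn_trans (ltn_ord i0).
have a0 : 0 <= w a.
  have : 0 <= \sum_(l < k) w a by rewrite -[leLHS]w0; apply: ler_sum => l _.
  by rewrite sumr_const card_ord pmulrn_lge0.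
have b0 : w b <= 0.
  have : \sum_(l < k) w b <= 0 by rewrite -[leRHS]w0; apply: ler_sum => l _.
  by rewrite sumr_const card_ord pmulrn_lle0.
have ab l : `|w l| <= w a - w b.
  by rewrite ler_norml; have := aP l; have := bP l; lra.
exists a, b; split=> //; rewrite -subr_gt0.
by apply: lt_le_trans (ab i0); rewrite normr_gt0.
Qed.

(** * Cumulative distribution functions *)

Lemma probability_itvoc d (T : measurableType d) (R : realType)
    (P : probability T R) (X : {RV P >-> R}) (a b : R) : a <= b ->
  P (X @^-1` `]a, b]%classic) = (cdf X b - cdf X a)%E.
Proof.
move=> ab.
have -> : `]a, b]%classic = `]-oo, b] `\` `]-oo, a].
  by rewrite -[RHS]setCK setCD setCitvl setUC -[LHS]setCK setCitv.
have fin : (distribution P X `]-oo, b] < +oo)%E.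
  by rewrite -ge0_fin_numE// fin_num_measure.
have := @measureD _ _ _ (distribution P X) `]-oo, b]%classic `]-oo, a]%classic.
by rewrite (@setIidr _ `]-oo, b] `]-oo, a]); [exact|exact: subset_itvl].
Qed.

Lemma eq_cdf_eq_law d (T : measurableType d) (R : realType)
    (P : probability T R) (X Y : {RV P >-> R}) :
  cdf X =1 cdf Y -> forall A : set R, measurable A ->
  P (X @^-1` A) = P (Y @^-1` A).
Proof.
move=> XY A mA.
apply: (measure_unique (@ocitv R) (fun n => `]- n%:R, n%:R]%classic) _ _ _ _
  (distribution P X) (distribution P Y)) => // {A mA}.
- exact: ocitvI.
- by move=> n; exact: is_ocitv.
- exact: bigcup_itvT.
- move=> _ [[a b]]/= _ <-; rewrite /distribution /pushforward.
  have [ab|/ltW ba] := leP a b; first by rewrite !probability_itvoc // !XY.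
  by rewrite set_itv_ge ?preimage_set0 // bnd_simp -leNgt.
- by move=> n; rewrite -ge0_fin_numE// fin_num_measure.
Qed.

(** Without such an interval, [F] would be bounded on the whole line by its
    values near 0, which tend to 0. *)
Lemma cumulative_geometric_jump (R : realType)
    (F : cumulativeBounded (0 : R) (1 : R)) (h : R) :
  F 0 = 0 -> 0 < h -> exists2 c, 0 < c & F c < F (c * (1 + h)).
Proof.
move=> F0 h0; apply: contrapT => noc.
have step c : 0 < c -> F (c * (1 + h)) <= F c.
  by move=> c0; rewrite leNgt; apply/negP => Fc; apply: noc; exists c.
have iter n c : 0 < c -> F (c * (1 + h) ^+ n) <= F c.
  elim: n c => [|n IH] c c0; first by rewrite expr0 mulr1.
  rewrite exprS mulrA; apply: le_trans (IH _ _) (step _ c0).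
  by rewrite mulr_gt0 // addr_gt0.
have flat c x : 0 < c -> F x <= F c.
  move=> c0; pose n := Num.bound `|x / c / h|.
  apply: le_trans (iter n c c0); apply: cumulative_is_nondecreasing.
  have bernoulli m : 1 + h *+ m <= (1 + h) ^+ m.
    elim: m => [|m IH]; first by rewrite mulr0n addr0 expr0.
    rewrite exprS; apply: le_trans (ler_wpM2l _ IH); last first.
      by rewrite addr_ge0 ?ltW.
    have : 0 <= h * (h *+ m) by rewrite mulr_ge0 ?mulrn_wge0 ?ltW.
    by rewrite mulrS; set y := h *+ m; lra.
  rewrite mulrC -ler_pdivrMr //; apply: le_trans (bernoulli n).
  apply: le_trans (_ : h *+ n <= _); last by rewrite lerDr.
  rewrite -mulr_natl -ler_pdivrMr //.
  by apply: le_trans (ler_norm _) _; exact/ltW/archi_boundP/normr_ge0.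
have [x Fx] : exists x, 2^-1 < F x.
  have /(_ _ 2^-1) H := cvgr_gt (1 : R) (cumulativey F).
  have [|x Fx] := @filter_ex _ _ proper_pinfty_nbhs _ (H _); last by exists x.
  by rewrite invf_lt1 // ltr1n.
have [c c0 Fc] : exists2 c, 0 < c & F c < 2^-1.
  have F0cvg : F x @[x --> (0 : R)^'+] --> (0 : R).
    by rewrite -[X in _ --> X]F0; exact: cumulative_is_right_continuous.
  have /(_ _ 2^-1) := cvgr_lt (0 : R) F0cvg.
  rewrite invr_gt0 ltr0n => /(_ isT) H.
  near (0 : R)^'+ => c; exists c; first by near: c; exact: nbhs_right_gt.
  by near: c.
by have := flat c x c0; lra.
Unshelve. all: by end_near. Qed.

(** * Exchangeability of independent identically distributed variables *)

Section rectangles.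
Context {R : realType} (k : nat).

(** The product set of the [A i]. *)
Definition box (A : 'I_k -> set R) : set 'cV[R]_k :=
  [set x | forall i, A i (x i 0)].

Lemma measurable_box A : (forall i, measurable (A i)) -> measurable (box A).
Proof.
move=> mA.
have -> : box A =
    \bigcap_(i in [set: 'I_k]) (fun x : 'cV[R]_k => x i 0) @^-1` A i.
  by apply/seteqP; split=> x H i //=; exact: H.
apply: fin_bigcap_measurable => // i _.
by rewrite -[X in measurable X]setTI; exact: measurable_mxE.
Qed.

(** The measurable boxes generate the product sigma-algebra. *)
Lemma measurable_cV_boxE :
  measurable = <<s [set box A | A in [set A | forall i, measurable (A i)]] >>
    :> set (set 'cV[R]_k).
Proof.
apply/seteqP; split.
- apply: smallest_sub; first exact: smallest_sigma_algebra.
  move=> _ [[i j] _ [B mB <-]] /=; rewrite setTI; apply: sub_sigma_algebra.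
  exists (fun l => if l == i then B else setT).
    by move=> l /=; case: ifP.
  apply/seteqP; split=> x /=.
    by move=> /(_ i); rewrite eqxx (ord1 j).
  by move=> Bx l; case: eqP => // ->; rewrite (ord1 j) in Bx.
- apply: smallest_sub; first exact: sigma_algebra_measurable.
  by move=> _ [A mA <-]; exact: measurable_box.
Qed.

End rectangles.

Section exchangeable.
Context {d} {T : measurableType d} {R : realType} {P : probability T R}.
Context {k : nat}.
Variable V : 'I_k -> {RV P >-> R}.

(** The random vector whose entries are the [V i], permuted by [s]. *)
Definition permuted_vector (s : 'S_k) (w : T) : 'cV[R]_k := \col_i V (s i) w.

Lemma measurable_permuted_vector s :
  measurable_fun [set: T] (permuted_vector s).
Proof.
apply: measurable_fun_mxP => i j.
under eq_fun do rewrite mxE.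
exact: measurable_funPT.
Qed.

HB.instance Definition _ (s : 'S_k) := isMeasurableFun.Build _ _ _ _
  (permuted_vector s) (measurable_permuted_vector s).

Lemma permuted_vector_box (s : 'S_k) (A : 'I_k -> set R) :
  mutually_independent V -> (forall i, measurable (A i)) ->
  P (permuted_vector s @^-1` box A) = (\prod_(i < k) P (V (s i) @^-1` A i))%E.
Proof.
move=> ind mA.
have := ind [set: 'I_k]%SET (fun i => A ((s^-1)%g i)) (fun i => mA _).
rewrite (_ : \bigcap_(i in _) _ = permuted_vector s @^-1` box A).
  move=> ->; rewrite (reindex_inj (@perm_inj _ s)) /=.
  by apply: eq_big => [i|i _]; [rewrite inE|rewrite permK].
apply/seteqP; split=> w /=.
  by move=> H i; rewrite mxE; have := H (s i); rewrite /= permK inE; exact.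
by move=> H i _ /=; have := H ((s^-1)%g i); rewrite mxE permKV.
Qed.

Lemma exchangeable :
  mutually_independent V -> (forall i j, cdf (V i) =1 cdf (V j)) ->
  forall (s : 'S_k) (E : set 'cV[R]_k), measurable E ->
  P (permuted_vector s @^-1` E) = P (permuted_vector 1%g @^-1` E).
Proof.
move=> ind hV s E mE.

have mbox s' A : (forall i, measurable (A i)) ->
    P (permuted_vector s' @^-1` box A) = (\prod_(i < k) P (V i @^-1` A i))%E.
  move=> mA; rewrite permuted_vector_box //; apply: eq_bigr => i _.
  exact: eq_cdf_eq_law.
change (distribution P (permuted_vector s) E =
        distribution P (permuted_vector 1%g) E).
apply: (measure_unique _ (fun=> setT) (@measurable_cV_boxE R k) _ _ _
  (distribution P (permuted_vector s))
  (distribution P (permuted_vector 1%g))) => //.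
- move=> _ _ [A mA <-] [B mB <-]; exists (fun i => A i `&` B i).
    by move=> i /=; apply: measurableI; [exact: mA|exact: mB].
  apply/seteqP; split=> x /=.
    by move=> H; split=> i; have [] := H i.
  by move=> [HA HB] i; split; [exact: HA|exact: HB].
- by move=> i; exists (fun=> setT) => //=; apply/seteqP; split.
- by rewrite bigcup_const//; exists 0%N.
- by move=> _ [A mA <-]; rewrite /= /distribution /pushforward !mbox.
- by move=> _; rewrite -ge0_fin_numE// fin_num_measure.
Qed.

End exchangeable.

(** * Half-spaces under an exchangeable law *)

Lemma measure_bigsetU_le d (T : measurableType d) (R : realType)
    (mu : {measure set T -> \bar R}) (I : Type) (r : seq I) (A : I -> set T) :
  (forall i, measurable (A i)) ->
  (mu (\big[setU/set0]_(i <- r) A i) <= \sum_(i <- r) mu (A i))%E.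
Proof.
move=> mA; elim: r => [|i r IH]; first by rewrite !big_nil measure0.
rewrite !big_cons; apply: le_trans (leeD2l _ IH).
by apply: measureU2 => //; apply: bigsetU_measurable.
Qed.

Section exchangeable_law.
Context {R : realType} {k : nat} (mu : probability 'cV[R]_k R).

(** The closed half-space through the origin with inner normal [a]. *)
Definition halfspace (a : 'I_k -> R) : set 'cV[R]_k :=
  [set x | 0 <= \sum_i a i * x i 0].

Lemma measurable_halfspace a : measurable (halfspace a).
Proof.
have mf : measurable_fun [set: 'cV[R]_k]
    (fun x : 'cV[R]_k => \sum_i a i * x i 0).
  apply: measurable_sum => i; apply: measurable_funM => //.
  exact: measurable_mxE.
have -> : halfspace a = setT `&` (fun x : 'cV[R]_k => \sum_i a i * x i 0)
    @^-1` `[0, +oo[.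
  by rewrite setTI; apply/seteqP; split=> x; rewrite /halfspace /= in_itv andbT.
exact: mf.
Qed.

Hypothesis exch : forall (s : 'S_k) (E : set 'cV[R]_k), measurable E ->
  mu [set x | E (row_perm s x)] = mu E.

Lemma halfspace_perm (J : set R) (a : 'I_k -> R) (s : 'S_k) : measurable J ->
  mu (box (fun=> J) `&` halfspace (a \o s)) =
  mu (box (fun=> J) `&` halfspace a).
Proof.
move=> mJ; rewrite -[RHS](exch (s^-1)%g); last first.
  by apply: measurableI; [exact: measurable_box|exact: measurable_halfspace].
congr (mu _); apply/seteqP; split=> x [/= Jx Hx]; split=> /=.
- by move=> i; rewrite mxE; exact: Jx.
- move: Hx; rewrite /halfspace /= (reindex_inj (@perm_inj _ (s^-1)%g)) /=.
  by congr (0 <= _); apply: eq_bigr => i _; rewrite mxE permKV.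
- by move=> i; have := Jx (s i); rewrite mxE permK.
- move: Hx; rewrite /halfspace /=.
  rewrite [in X in X -> _](reindex_inj (@perm_inj _ s)) /=.
  by congr (0 <= _); apply: eq_bigr => i _; rewrite mxE permK.
Qed.

(** A half-space with normal of sum zero has at least a share [1 / k!] of every
    cube: its [k!] images under permutations of the coordinates cover the
    space. *)
Lemma halfspace_mass (J : set R) (a : 'I_k -> R) : measurable J ->
  \sum_i a i = 0 ->
  (mu (box (fun=> J)) <= k`!%:R%:E * mu (box (fun=> J) `&` halfspace a))%E.
Proof.
move=> mJ a0; have mbox : measurable (box (fun=> J) : set 'cV[R]_k).
  exact: measurable_box.
have mA s : measurable (box (fun=> J) `&` halfspace (a \o (s : 'S_k))).
  by apply: measurableI => //; exact: measurable_halfspace.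
have sub : box (fun=> J) `<=`
    \big[setU/set0]_(s : 'S_k) (box (fun=> J) `&` halfspace (a \o s)).
  move=> x Jx; rewrite -bigcup_seq.
  have [s Hs] : exists s : 'S_k, 0 <= \sum_i a (s i) * x i 0.
    apply: contrapT => /forallNP H.
    have : \sum_(s : 'S_k) \sum_i a (s i) * x i 0 < \sum_(s : 'S_k) 0.
      apply: ltr_sum => [|s _]; last by rewrite ltNge; apply/negP; exact: H.
      by apply/hasP; exists 1%g; rewrite ?mem_index_enum.
    by rewrite big1_eq (sum_perm0 (fun i => x i 0) a0) ltxx.
  by exists s => //=; rewrite mem_index_enum.
have mU : measurable (\big[setU/set0]_(s : 'S_k)
    (box (fun=> J) `&` halfspace (a \o s))).
  exact: bigsetU_measurable.
apply: (@le_trans _ _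
  (\sum_(s : 'S_k) mu (box (fun=> J) `&` halfspace (a \o s)))%E).
  apply: le_trans (measure_bigsetU_le _ _ mA).
  by apply: le_measure; [exact: mem_set|exact: mem_set|exact: sub].
rewrite (eq_bigr (fun=> mu (box (fun=> J) `&` halfspace a))); last first.
  by move=> s _; exact: halfspace_perm.
rewrite -[mu (_ `&` _)]fineK ?fin_num_measure //; last first.
  by apply: measurableI => //; exact: measurable_halfspace.
by rewrite sumEFin -EFinM lee_fin sumr_const card_Sn -[leLHS]mulr_natl.
Qed.

Hypothesis pos : mu (box (fun=> `]0, +oo[%classic)) = 1%E.

Lemma measure_posI (E : set 'cV[R]_k) : measurable E ->
  mu (box (fun=> `]0, +oo[%classic) `&` E) = mu E.
Proof.
move=> mE; set Pos := box _.
have mPos : measurable Pos by exact: measurable_box.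
have PosC0 : mu (~` Pos) = 0%E by rewrite probability_setC // pos subee.
have ED0 : mu (E `\` Pos) = 0%E.
  apply/eqP; rewrite eq_le measure_ge0 andbT -PosC0.
  apply: le_measure; [apply: mem_set; exact: measurableD
                     |apply: mem_set; exact: measurableC|by move=> x []].
have -> : mu E = mu ((E `&` Pos) `|` (E `\` Pos)) by rewrite setUIDK.
rewrite measureU0 ?[Pos `&` E]setIC //; first exact: measurableI.
exact: measurableD.
Qed.

Lemma pos_box (x : 'cV[R]_k) :
  box (fun=> `]0, +oo[%classic) x -> forall i, 0 < x i 0.
Proof. by move=> H i; have := H i; rewrite /= in_itv andbT. Qed.

(** Replacing the normal [v] by [v - m], with [m] positive, shrinks a half-space
    within the positive orthant.  The part that is lost contains the portion of
    the half-space in a cube so narrow, relative to its distance to the origin,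
    that [\sum_i v i * x i 0 < m * \sum_i x i 0] there. *)
Lemma halfspace_shift_gap (k0 : (0 < k)%N) (v : 'I_k -> R) (c h W m : R) :
  \sum_i v i = 0 -> 0 < c -> 0 < W -> 0 < h -> (forall i, `|v i| <= W) ->
  W * h <= m ->
  (mu (halfspace (fun i => v i - m)%R) +
   mu (box (fun=> `]c, (c * (1 + h))%R]%classic) `&` halfspace v)
   <= mu (halfspace v))%E.
Proof.
move=> v0 c0 W0 h0 vW Wm.
have m0 : 0 < m by apply: lt_le_trans Wm; rewrite mulr_gt0.
set Pos : set 'cV[R]_k := box (fun=> `]0, +oo[%classic).
set B : set 'cV[R]_k := box _.
have mPos : measurable Pos by exact: measurable_box.
have mB : measurable B by exact: measurable_box.
have mH := measurable_halfspace.
rewrite -[X in (X + _)%E]measure_posI // -measureU;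
  [|exact: measurableI|exact: measurableI|].
- apply: le_measure; [apply: mem_set..|] => //.
    by apply: measurableU; exact: measurableI.
  move=> x [[/pos_box x0]|[]//]; rewrite /halfspace /=.
  rewrite (eq_bigr (fun i => v i * x i 0 - m * x i 0)) => [|i _]; last first.
    by rewrite mulrBl.
  rewrite sumrB -mulr_sumr subr_ge0; apply: le_trans.
  by apply: mulr_ge0; [exact: ltW|apply: sumr_ge0 => i _; exact/ltW/x0].
- rewrite -subset0 => x [[_ Hx] [Bx _]].
  move: Hx; rewrite /halfspace /= leNgt => /negP; apply.
  (* Since v has sum zero, x i 0 may be replaced by x i 0 - c in the first
     product. *)
  have -> : \sum_i (v i - m) * x i 0 =
      \sum_i (v i * (x i 0 - c) - m * x i 0).
    rewrite -[RHS]addr0 -[X in _ + X](mulr0 c) -[X in c * X]v0.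
    rewrite mulr_sumr -big_split /=.
    by apply: eq_bigr => i _; ring.
  have neg i : v i * (x i 0 - c) - m * x i 0 < 0.
    have := Bx i; rewrite /= in_itv => /andP[cx xc].
    have := vW i; rewrite ler_norml => /andP[_ vi].
    have xc0 : 0 <= x i 0 - c by rewrite subr_ge0 ltW.
    have : v i * (x i 0 - c) <= W * (c * h).
      apply: le_trans (ler_wpM2r xc0 vi) _.
      apply: ler_wpM2l; first exact: ltW.
      by rewrite lerBlDl -[X in X + _]mulr1 -mulrDr.
    have : W * h * c <= m * c by apply: ler_wpM2r => //; exact: ltW.
    have : m * c < m * x i 0 by rewrite ltr_pM2l.
    by rewrite (mulrC c) mulrA subr_lt0; lra.
  apply: (@lt_le_trans _ _ (\sum_(i < k) 0)); last by rewrite big1_eq.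
  apply: ltr_sum => //.
  by apply/hasP; exists (Ordinal k0); rewrite ?mem_index_enum.
Qed.

End exchangeable_law.

(** * Depth under the normalized law *)

Section normalized_law.
Context {R : realType} {k : nat} (mu : probability 'cV[R]_k R).
Hypothesis k0 : (0 < k)%N.
Hypothesis exch : forall (s : 'S_k) (E : set 'cV[R]_k), measurable E ->
  mu [set x | E (row_perm s x)] = mu E.
Hypothesis pos : mu (box (fun=> `]0, +oo[%classic)) = 1%E.
(* Some cubes that are arbitrarily narrow, relative to their distance to the
   origin, have positive mass. *)
Hypothesis conc : forall h : R, 0 < h -> exists2 c : R, 0 < c &
  (0 < mu (box (fun=> `]c, (c * (1 + h))%R]%classic)))%E.

Lemma halfspace_mass_ge (B : set R) (e : R) (a : 'I_k -> R) : measurable B ->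
  (e%:E <= mu (box (fun=> B)))%E -> \sum_i a i = 0 ->
  ((e / k`!%:R)%:E <= mu (box (fun=> B) `&` halfspace a))%E.
Proof.
move=> mB eB a0; rewrite mulrC EFinM lee_pdivrMl ?ltr0n ?fact_gt0 //.
exact: le_trans eB (halfspace_mass exch mB a0).
Qed.

Lemma boxT : box (fun=> setT) = setT :> set 'cV[R]_k.
Proof. by apply/seteqP; split. Qed.

(** A strict comparison, uniform in [w]: among the permutations [v] of [w] there
    is one for which shifting [v] by its inner product with [t] lowers the mass
    of the half-space by at least [e], and [halfspace v] has the mass of
    [halfspace w]. *)
Lemma uniform_gap (t : 'I_k -> R) (i0 : 'I_k) : \sum_i t i = 0 -> t i0 != 0 ->
  exists2 e : R, 0 < e & forall (w : 'I_k -> R) (j0 : 'I_k),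
    \sum_i w i = 0 -> w j0 != 0 ->
  exists s : 'S_k,
    (mu (halfspace (fun i => w (s i) - \sum_j w (s j) * t j)%R) + e%:E
      <= mu (halfspace w))%E.
Proof.
move=> t0 ti0; have [p [q [tqp _]]] := exists_oscillation t0 ti0.
(* By the choice of h, the shift provided by exists_perm_align is at least h
   times the oscillation of w. *)
pose h := (t p - t q) / k`!%:R.
have h0 : 0 < h by rewrite divr_gt0 ?subr_gt0 // ltr0n fact_gt0.
have [c c0 cB] := conc h0.
set J : set R := `]c, (c * (1 + h))%R]%classic in cB.
have mJ : measurable J by exact: measurable_itv.
have mB : measurable (box (fun=> J) : set 'cV[R]_k) by exact: measurable_box.
pose e := fine (mu (box (fun=> J))).
have eE : mu (box (fun=> J)) = e%:E by rewrite fineK // fin_num_measure.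
exists (e / k`!%:R).
  by rewrite divr_gt0 ?ltr0n ?fact_gt0 // -lte_fin -eE.
move=> w j0 w0 wj0; have [a [b [wba wW]]] := exists_oscillation w0 wj0.
have ab : a != b by apply: contraTneq wba => ->; rewrite ltxx.
have pq : p != q by apply: contraTneq tqp => ->; rewrite ltxx.
have [s hs] := exists_perm_align t w0 ab pq.
exists s.
have ws0 : \sum_i w (s i) = 0.
  by rewrite -[RHS]w0 [RHS](reindex_inj (@perm_inj _ s)).
have -> : mu (halfspace w) = mu (halfspace (w \o s)).
  by have := halfspace_perm exch w s (@measurableT _ R); rewrite boxT !setTI.
apply: le_trans (@halfspace_shift_gap _ _ _ pos k0 (w \o s) c h (w a - w b)
  (\sum_j w (s j) * t j) _ _ _ _ _ _) => //.
- by apply: leeD2l; apply: halfspace_mass_ge; rewrite ?eE.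
- by rewrite subr_gt0.
- by move=> i; exact: wW.
- by rewrite /h mulrA.
Qed.

(* The law of x / \sum_i x i 0 when x has law mu. *)
Variable Q : probability 'cV[R]_k R.
Hypothesis hQ : forall A, measurable A ->
  Q A = mu [set x : 'cV[R]_k | A ((\sum_i x i 0)^-1 *: x)].

Let dot_shift (u x theta : 'cV[R]_k) :
  (u^T *m (x - theta)) 0 0 = \sum_i u i 0 * (x i 0 - theta i 0).
Proof. by rewrite mxE; apply: eq_bigr => i _; rewrite !mxE. Qed.

Let dot_normalize (u x theta : 'cV[R]_k) : \sum_i x i 0 != 0 ->
  \sum_i u i 0 * (((\sum_i x i 0)^-1 *: x) i 0 - theta i 0) =
  (\sum_i x i 0)^-1 * \sum_i (u i 0 - \sum_j u j 0 * theta j 0) * x i 0.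
Proof.
set S := \sum_i x i 0; set c := \sum_j u j 0 * theta j 0 => S0.
rewrite (eq_bigr (fun i => S^-1 * (u i 0 * x i 0) - u i 0 * theta i 0));
  last by move=> i _; rewrite !mxE; ring.
rewrite [in RHS](eq_bigr (fun i => u i 0 * x i 0 - c * x i 0)); last first.
  by move=> i _; rewrite mulrBl.
by rewrite !sumrB -!mulr_sumr mulrBr [X in _ = _ - X]mulrCA mulVf // mulr1.
Qed.

Let sum_pos (x : 'cV[R]_k) : (forall i, 0 < x i 0) -> 0 < \sum_i x i 0.
Proof.
move=> x0; rewrite (bigD1 (Ordinal k0)) //= ltr_wpDr //.
by apply: sumr_ge0 => i _; exact: ltW.
Qed.

Lemma mass_halfspaceE (u theta : 'cV[R]_k) :
  Q [set x | 0 <= (u^T *m (x - theta)) 0 0] =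
  mu (halfspace (fun i => u i 0 - \sum_j u j 0 * theta j 0)).
Proof.
set A := [set x | _].
have mentry (i : 'I_k) :
    measurable_fun [set: 'cV[R]_k] (fun x : 'cV[R]_k => x i 0).
  exact: measurable_mxE.
have mA : measurable A.
  have mf : measurable_fun [set: 'cV[R]_k]
      (fun x : 'cV[R]_k => \sum_i u i 0 * (x i 0 - theta i 0)).
    apply: measurable_sum => i; apply: measurable_funM => //.
    exact: measurable_funB.
  have -> : A = setT `&`
      (fun x : 'cV[R]_k => \sum_i u i 0 * (x i 0 - theta i 0)) @^-1` `[0, +oo[.
    rewrite setTI; apply/seteqP; split=> x;
    by rewrite /A /= dot_shift in_itv andbT.
  exact: mf.
have mN : measurable_fun [set: 'cV[R]_k]
    (fun x : 'cV[R]_k => (\sum_i x i 0)^-1 *: x).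
  apply: measurable_fun_mxP => i j; rewrite (ord1 j).
  under eq_fun do rewrite mxE.
  apply: measurable_funM => //.
  apply: measurableT_comp; first exact: measurable_invr.
  exact: measurable_sum.
have mNA : measurable [set x : 'cV[R]_k | A ((\sum_i x i 0)^-1 *: x)].
  by have := mN measurableT A mA; rewrite setTI.
rewrite hQ // -(measure_posI pos mNA) -[RHS](measure_posI pos) //; last first.
  exact: measurable_halfspace.
congr (mu _); apply/seteqP; split=> x [Hx].
all: have xp := pos_box Hx.
all: have S0 := sum_pos xp.
all: rewrite /A /halfspace /= dot_shift.
all: rewrite dot_normalize ?gt_eqF //.
all: by rewrite pmulr_rge0 ?invr_gt0.
Qed.

Lemma halfspaceZ (r : R) (a : 'I_k -> R) : 0 < r ->
  halfspace (fun i => r * a i) = halfspace a.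
Proof.
move=> r0; apply/funext => x; rewrite /halfspace /mkset.
rewrite (eq_bigr (fun i => r * (a i * x i 0))) => [|i _]; last by rewrite mulrA.
by rewrite -mulr_sumr pmulr_rge0.
Qed.

(** Any nonzero direction, not only a unit one, bounds the depth. *)
Lemma halfspace_depth_le (theta : 'cV[R]_k) (v : 'I_k -> R) (i0 : 'I_k) :
  v i0 != 0 ->
  (halfspace_depth Q theta <=
   mu (halfspace (fun i => v i - \sum_j v j * theta j 0)%R))%E.
Proof.
move=> vi0; pose n2 := \sum_i v i ^+ 2.
have n20 : 0 < n2.
  rewrite /n2 (bigD1 i0) //= ltr_wpDr //; last by rewrite exprn_even_gt0.
  by apply: sumr_ge0 => i _; exact: sqr_ge0.
have N0 : 0 < (Num.sqrt n2)^-1 by rewrite invr_gt0 sqrtr_gt0.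
pose u : 'cV[R]_k := \col_i ((Num.sqrt n2)^-1 * v i).
apply: ge_ereal_inf; exists (Q [set x | 0 <= (u^T *m (x - theta)) 0 0]).
  exists u => //; rewrite /unit_sphere /= mxE.
  under eq_bigr do rewrite !mxE -expr2 exprMn.
  by rewrite -mulr_sumr exprVn sqr_sqrtr ?ltW // mulVf // gt_eqF.
rewrite mass_halfspaceE -(halfspaceZ (fun i => v i - _) N0).
rewrite le_eqVlt; apply/orP; left; apply/eqP; congr (mu (halfspace _)).
apply/funext => i; rewrite mxE mulrBr mulr_sumr; congr (_ - _).
by apply: eq_bigr => j _; rewrite mxE mulrA.
Qed.

Let center : 'cV[R]_k := const_mx k%:R^-1.

(** Only half-spaces with a normal of sum zero compete for the depth of the
    centre, apart from the trivial one with normal zero. *)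
Lemma depth_center_ge (e : \bar R) : (e <= 1)%E ->
  (forall (w : 'I_k -> R) (j0 : 'I_k), \sum_i w i = 0 -> w j0 != 0 ->
    (e <= mu (halfspace w))%E) ->
  (e <= halfspace_depth Q center)%E.
Proof.
move=> e1 H; apply: le_ereal_inf_tmp => _ [u _ <-]; rewrite mass_halfspaceE.
set w := fun i => _.
have w0 : \sum_i w i = 0.
  rewrite sumrB sumr_const card_ord /center.
  under [X in _ - X *+ _]eq_bigr do rewrite mxE.
  by rewrite -mulr_suml -[X in _ - X]mulr_natr divfK ?subrr // pnatr_eq0 -lt0n.
have [[j wj]|wz] := pselect (exists j, w j != 0); first exact: (H w j).
suff -> : halfspace w = setT by rewrite probability_setT.
apply/seteqP; split=> // x _; rewrite /halfspace /= big1 // => i _.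
have [->|wi] := eqVneq (w i) 0; first by rewrite mul0r.
by case: wz; exists i.
Qed.

Lemma depth_center_gt (theta : 'cV[R]_k) : theta <> center ->
  (halfspace_depth Q theta < halfspace_depth Q center)%E.
Proof.
move=> thetaNc; have kn0 : k%:R != 0 :> R by rewrite pnatr_eq0 -lt0n.
have [theta1|theta1] := eqVneq (\sum_i theta i 0) 1; last first.
  apply: (@le_lt_trans _ _ 0%E).
    (* In the direction (r, ..., r), the normal of the half-space is the
       constant vector - r ^+ 2. *)
    pose r := \sum_i theta i 0 - 1.
    have r0 : r != 0 by rewrite subr_eq0.
    apply: le_trans (@halfspace_depth_le theta (fun=> r) (Ordinal k0) r0) _.
    rewrite -(measure_posI pos (measurable_halfspace _)).
    set E := _ `&` _; suff -> : E = set0 by rewrite measure0.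
    rewrite /E -subset0 => x [/pos_box x0]; rewrite /halfspace /= leNgt.
    move=> /negP; apply; rewrite -mulr_sumr -mulr_sumr.
    have S0 := sum_pos x0.
    have -> : r - r * \sum_i theta i 0 = - r ^+ 2 by rewrite /r; ring.
    by rewrite nmulr_rlt0 // oppr_lt0 exprn_even_gt0.
  have f0 : 0 < 1 / k`!%:R :> R by rewrite divr_gt0 // ltr0n fact_gt0.
  apply: (@lt_le_trans _ _ (1 / k`!%:R)%:E); first by rewrite lte_fin.
  apply: depth_center_ge.
    by rewrite lee_fin ler_pdivrMr ?ltr0n ?fact_gt0 // mul1r ler1n fact_gt0.
  move=> w j0 w0 wj0.
  have := @halfspace_mass_ge setT 1 w measurableT.
  by rewrite boxT setTI probability_setT; apply.
pose t i := theta i 0 - k%:R^-1.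
have t0 : \sum_i t i = 0.
  rewrite sumrB theta1 sumr_const card_ord -[X in _ - X]mulr_natr.
  by rewrite mulVf // subrr.
have [i0 ti0] : exists i0, t i0 != 0.
  apply: contrapT => /forallNP H; apply: thetaNc; apply/colP => i.
  rewrite mxE; apply/eqP; rewrite -subr_eq0; apply: contrapT => /negP.
  exact: H.
have [e e0 gap] := uniform_gap t0 ti0.
have le_gap (w : 'I_k -> R) (j0 : 'I_k) : \sum_i w i = 0 -> w j0 != 0 ->
    (halfspace_depth Q theta + e%:E <= mu (halfspace w))%E.
  move=> w0 wj0; have [s H] := gap w j0 w0 wj0.
  have ws : (w \o s) ((s^-1)%g j0) != 0 by rewrite /= permKV.
  apply: le_trans H; apply: leeD2r.
  apply: le_trans (@halfspace_depth_le theta (w \o s) _ ws) _.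
  rewrite le_eqVlt; apply/orP; left; apply/eqP; congr (mu (halfspace _)).
  apply/funext => i /=; congr (_ - _).
  under [RHS]eq_bigr do rewrite mulrBr.
  rewrite sumrB -mulr_suml.
  have -> : \sum_i w (s i) = 0.
    by rewrite -[RHS]w0 [RHS](reindex_inj (@perm_inj _ s)).
  by rewrite mul0r subr0.
have fin : halfspace_depth Q theta \is a fin_num.
  rewrite ge0_fin_numE.
    apply: le_lt_trans (@halfspace_depth_le theta t i0 ti0) _.
    by rewrite -ge0_fin_numE // fin_num_measure //; exact: measurable_halfspace.
  by apply: le_ereal_inf_tmp => _ [u _ <-]; exact: measure_ge0.
apply: (@lt_le_trans _ _ (halfspace_depth Q theta + e%:E)%E).
  by rewrite lteDl // lte_fin.
apply: depth_center_ge => [|w j0]; last exact: le_gap.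
apply: le_trans (le_gap t i0 t0 ti0) _.
by apply: probability_le1; exact: measurable_halfspace.
Qed.

Lemma deepest_points_center : deepest_points Q = [set center].
Proof.
apply/seteqP; split=> theta.
  move=> H; apply: contrapT => /depth_center_gt.
  by rewrite ltNge H.
move=> -> eta; have [->|/eqP/depth_center_gt/ltW] := eqVneq eta center => //.
Qed.

End normalized_law.

(** The affine hull of a point has dimension 0; Lebesgue measure on R^0 is the
    unit mass at its only point. *)
Lemma is_barycenter_set1 (R : realType) (k : nat) (m : 'cV[R]_k) :
  is_barycenter [set m] m.
Proof.
exists 0%N, m, 0 => phi S mu.
have phiE y : phi y = m by rewrite /phi mul0mx addr0.
have ST : S = setT.
  by rewrite /S; apply/seteqP; split=> // y _ /=; rewrite phiE.
have muS : mu S = 1%E by rewrite ST /mu /= diracT.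
have intc (i : 'I_k) : (fun y => phi y i 0) = cst (m i 0).
  by apply/funext => y; rewrite phiE.
split.
- by apply/matrixP => -[].
- apply/seteqP; split=> x.
    move=> [n [p [c [pm c1 ->]]]]; exists 0; rewrite ?phiE //.
    rewrite (eq_bigr (fun i => c i *: m)) => [|i _]; last by rewrite pm.
    by rewrite -scaler_suml c1 scale1r.
  move=> [y _ <-]; rewrite phiE; exists 1%N, (fun=> m), (fun=> 1).
  by split=> //; rewrite !big_ord1 ?scale1r.
- by rewrite ST.
- by rewrite muS lte01 ltry.
- move=> i; rewrite intc; have mS : measurable S by rewrite ST.
  split.
    exact: (@finite_measure_integrable_cst _ _ _
      (\d_(0 : 'cV[R]_0) : {finite_measure set _ -> \bar R}) S (m i 0) mS).
  have intm : (\int[mu]_(y in S) (cst (m i 0) y)%:E = (m i 0)%:E * mu S)%E.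
    exact: (integral_cst mu mS (m i 0)%:E).
  by rewrite /Rintegral intm muS mule1 divr1.
Qed.

(** * The Tukey median *)

Theorem theorem1 (R : realType) (k : nat) (hk : (2 <= k)%N)
  (F : cumulativeBounded (0 : R) (1 : R)) (hF : unimodal_cdf F)
  (d : measure_display) (T : measurableType d) (P : probability T R)
  (V : 'I_k -> {RV P >-> R})
  (hind : mutually_independent V)
  (hcdf : forall (i : 'I_k) (r : R), cdf (V i) r = (F r)%:E) :
  is_tukey_median (distribution P (normalize V)) (const_mx (k%:R^-1)).
Proof.
have k0 : (0 < k)%N by exact: ltn_trans hk.
have [F0 _] := hF.
have same i j : cdf (V i) =1 cdf (V j) by move=> r; rewrite !hcdf.
pose mu := distribution P (permuted_vector V 1%g).
have muE (E : set 'cV[R]_k) : mu E = P [set w | E (\col_i V i w)].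
  rewrite /mu /= /distribution /pushforward; congr (P _).
  apply/funext => w; congr (E _).
  by apply/colP => i; rewrite !mxE perm1.
have mu_box (A : 'I_k -> set R) : (forall i, measurable (A i)) ->
    mu (box A) = (\prod_(i < k) P (V i @^-1` A i))%E.
  move=> mA; rewrite /mu /= /distribution /pushforward permuted_vector_box //.
  by apply: eq_bigr => i _; rewrite perm1.
have exch (s : 'S_k) (E : set 'cV[R]_k) : measurable E ->
    mu [set x | E (row_perm s x)] = mu E.
  move=> mE; rewrite muE.
  transitivity (P (permuted_vector V s @^-1` E)); last exact: exchangeable.
  congr (P _); apply/funext => w; congr (E _).
  by apply/colP => i; rewrite !mxE.
have pos : mu (box (fun=> `]0, +oo[%classic)) = 1%E.
  rewrite mu_box // big1 // => i _.
  have -> : `]0, +oo[%classic = ~` `]-oo, 0 : R]%classic by rewrite setCitvl.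
  have mN : measurable (V i @^-1` `]-oo, 0 : R]%classic).
    by apply: measurable_funPTI; exact: measurable_itv.
  rewrite preimage_setC probability_setC //.
  have -> : P (V i @^-1` `]-oo, 0]) = 0%E.
    by rewrite -[LHS]/(cdf (V i) 0) hcdf F0.
  by rewrite sube0.
have conc (h : R) : 0 < h -> exists2 c : R, 0 < c &
    (0 < mu (box (fun=> `]c, (c * (1 + h))%R]%classic)))%E.
  move=> h0; have [c c0 Fc] := cumulative_geometric_jump F0 h0.
  exists c => //; rewrite mu_box //.
  apply: (big_ind (fun x : \bar R => (0 < x)%E)); first exact: lte01.
    by move=> x y x0 y0; rewrite mule_gt0.
  move=> i _; rewrite probability_itvoc.
    by rewrite !hcdf -EFinB lte_fin subr_gt0.
  by rewrite ler_peMr ?ltW // ltrDl.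
have law (A : set 'cV[R]_k) : measurable A -> distribution P (normalize V) A =
    mu [set x : 'cV[R]_k | A ((\sum_i x i 0)^-1 *: x)].
  move=> mA; rewrite muE /= /distribution /pushforward.
  congr (P _); apply/funext => w; congr (A _).
  apply/colP => i; rewrite !mxE mulrC; congr (_^-1 * _).
  by apply: eq_bigr => j _; rewrite mxE.
rewrite /is_tukey_median (deepest_points_center k0 exch pos conc law).
exact: is_barycenter_set1.
Qed.
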